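(* For all $n,m\in\mathbb{N}$ (with $n,m\ge 1$) we have $\gamma(M_n, M_m) = \frac{1}{\min(n,m)}$ and $\eta(M_n, M_m) = \eta_u(M_n, M_m) = \min(n,m)$.
   Context: $M_n$ is the algebra of complex $n\times n$ matrices with the operator norm. A positive element $X\in M_n\otimes M_m$ is separable if $X=\sum_i P_i\otimes Q_i$ is a finite sum with $0\le P_i\in M_n$ and $0\le Q_i\in M_m$. A linear map is positive if it maps positive elements to positive elements, contractive if its norm is at most $1$, and $\|\Phi\|_{cb}=\sup_k\|Id_k\otimes\Phi\|$ where $Id_k$ is the identity map of $M_k$. Define $\eta(M_n,M_m):=\sup\{\|\Phi\|_{cb} : \Phi:M_n\to M_m \text{ contractive positive map}\}$; $\eta_u(M_n,M_m):=\sup\{\|\Phi\|_{cb} : \Phi:M_n\to M_m \text{ unital positive map}\}$; $\gamma(M_n,M_m):=\sup\{r\in\mathbb{R}_+ : \mathbf{1}_n\otimes \mathbf{1}_m - x \text{ is separable for all } x=x^*\in M_n\otimes M_m \text{ with } \|x\|\le r\}$. *)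

(* Defs.v *)
From mathcomp Require Import all_boot all_order all_algebra.
From mathcomp Require Import complex mxtens.
From mathcomp Require Import classical_sets reals constructive_ereal ereal.

Set Implicit Arguments.
Unset Strict Implicit.
Unset Printing Implicit Defensive.

Import Order.TTheory GRing.Theory Num.Theory.

Local Open Scope ring_scope.
Local Open Scope complex_scope.
Local Open Scope classical_set_scope.

(* M_n (x) M_m is identified with 'M_(n * m) through the Kronecker product
   *t of mxtens.  Operator norms and suprema live in \bar R, so that no supremum
   carries a side condition of boundedness. *)

Section MatrixAlgebras.
Variable R : realType.
Local Notation C := R[i].

Definition vnorm n (v : 'cV[C]_n) : R :=
  Num.sqrt (\sum_i ComplexField.Normc.normc (v i 0) ^+ 2).

Definition opnorm n (A : 'M[C]_n) : \bar R :=
  ereal_sup [set (vnorm (A *m v))%:E | v in [set v | vnorm v <= 1]].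

(* On R[i], 0 <= z means that z is real and nonnegative. *)
Definition psdmx n (A : 'M[C]_n) : Prop :=
  A \is hermsymmx /\
  forall v : 'cV[C]_n, 0 <= ((v ^t*)%sesqui *m A *m v) 0 0.

Definition separable n m (X : 'M[C]_(n * m)) : Prop :=
  exists (N : nat) (P : 'I_N -> 'M[C]_n) (Q : 'I_N -> 'M[C]_m),
    (forall i, psdmx (P i) /\ psdmx (Q i)) /\ X = \sum_i P i *t Q i.

Section Maps.
Variables n m : nat.
Implicit Type Phi : 'M[C]_n -> 'M[C]_m.

Definition positive_map Phi : Prop := forall A, psdmx A -> psdmx (Phi A).

Definition unital_map Phi : Prop := Phi 1%:M = 1%:M.

Definition mapnorm Phi : \bar R :=
  ereal_sup [set opnorm (Phi A) | A in [set A | (opnorm A <= 1)%E]].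

Definition contractive_map Phi : Prop := (mapnorm Phi <= 1)%E.

Definition tens_block k (X : 'M[C]_(k * n)) (i j : 'I_k) : 'M[C]_n :=
  \matrix_(a, b) X (mxtens_index (i, a)) (mxtens_index (j, b)).

(* Id_k (x) Phi, using X = \sum_(i, j) E_ij (x) X_ij with X_ij in M_n. *)
Definition id_tens k Phi (X : 'M[C]_(k * n)) : 'M[C]_(k * m) :=
  \sum_(i < k) \sum_(j < k) delta_mx i j *t Phi (tens_block X i j).

End Maps.

Definition cbnorm n m (Phi : 'M[C]_n -> 'M[C]_m) : \bar R :=
  ereal_sup [set mapnorm (@id_tens n m k Phi) | k in [set k | (0 < k)%N]].

Definition eta n m : \bar R :=
  ereal_sup [set cbnorm Phi | Phi in
    [set Phi : {linear 'M[C]_n -> 'M[C]_m} |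
      contractive_map Phi /\ positive_map Phi]].

Definition eta_u n m : \bar R :=
  ereal_sup [set cbnorm Phi | Phi in
    [set Phi : {linear 'M[C]_n -> 'M[C]_m} |
      unital_map Phi /\ positive_map Phi]].

Definition gamma n m : \bar R :=
  ereal_sup [set r%:E | r in
    [set r : R | 0 <= r /\
      forall x : 'M[C]_(n * m), x \is hermsymmx -> (opnorm x <= r%:E)%E ->
        separable (1%:M *t 1%:M - x)]].

End MatrixAlgebras.

(* Main.v *)
From HB Require Import structures.
Require Import Defs.
From mathcomp Require Import all_boot all_order all_algebra.
From mathcomp Require Import reals constructive_ereal.
From mathcomp Require Import complex mxtens ring zify ereal.

(** Everything rests on one fact, [povm_contraction]: a contraction [y] in [M_q]
is [\sum_k l_k Q_k] with [|l_k| = 1], [Q_k >= 0] and [\sum_k Q_k = 1].  For a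
unitary this is its spectral decomposition.  For a general [y] the matrix
[[0 y; y* 0]] is a hermitian contraction, hence the mean of two unitaries
[h +- i sqrt (1 - h^2)]; multiplied by the unitary that exchanges the two
halves, it is still a mean of two unitaries, and has [y] as its upper left
corner.  The property survives means and compressions.

Lower bound for gamma.  Cut a hermitian contraction [X] of [M_p (x) M_q] into
[p^2] blocks [X_ij] of [M_q].  Writing [X_ij = \sum_k l_k Q_k] as above,
  [E_ii (x) 1 + E_jj (x) 1 - E_ij (x) X_ij - E_ji (x) X_ij*]
  [= \sum_k (E_ii + E_jj - l_k E_ij - l_k* E_ji) (x) Q_k],
and the left factor is the Gram matrix of a vector, so each of these terms is
separable.  Half of their sum over all [(i, j)] is [p 1 - X]
([tens_cone_contraction_l]); exchanging the factors replaces [p] by [q].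

Upper bound for eta and eta_u.  Let [Phi] be positive with [Phi 1 <= 1].
Applying [Phi] to [y = \sum_k l_k Q_k] shows that [Phi] is contractive
([russo_dye]).  The bound by [m] ([normle_ampl_codomain]) then follows by cutting
the image into [m^2] blocks, each of which is a contraction.  For the bound by
[n] ([normle_ampl_domain]), a positive map amplified by the identity sends
separable elements to positive ones, so [n 1 - X] is sent to a positive element;
for hermitian [X] this bounds the image of [X] by [n], and a general [X] is
replaced by the hermitian [[0 X; X* 0]].

Optimality ([ampl_flip_norm], [cone_flip_le]).  The flip
[F = \sum_ij E_ij (x) E_ji] is a contraction.  A unital positive map that
restricts to the transposition on the first [k = min (n, m)] coordinates sends
it to an element [Y] whose form at [\sum_(i < k) e_i (x) e_i], of squared norm
[k], is [k^2].  So [Y] has norm at least [k], and if [1 - r F] is separable then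
[k - r k^2 >= 0]. *)

Set Implicit Arguments.
Unset Strict Implicit.
Unset Printing Implicit Defensive.

Import Order.TTheory GRing.Theory Num.Theory.

Local Open Scope ring_scope.

Local Notation "A ^H" := ((A ^t*)%sesqui) (at level 8, format "A ^H").

(** * Adjoints, the scalar product and norm bounds *)

Section Vectors.
Variable C : numClosedFieldType.

Section Adjoint.
Variables p q r : nat.
Implicit Types (A B : 'M[C]_(p, q)).

Lemma trmxCD A B : (A + B)^H = A^H + B^H.
Proof. by apply/matrixP=> i j; rewrite !mxE rmorphD. Qed.

Lemma trmxCB A B : (A - B)^H = A^H - B^H.
Proof. by apply/matrixP=> i j; rewrite !mxE rmorphB. Qed.

Lemma trmxCZ c A : (c *: A)^H = c^* *: A^H.
Proof. by apply/matrixP=> i j; rewrite !mxE rmorphM. Qed.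

Lemma trmxCM A (B : 'M[C]_(q, r)) : (A *m B)^H = B^H *m A^H.
Proof. by rewrite trmx_mul map_mxM. Qed.

End Adjoint.

Lemma trmxC_sum p q I (s : seq I) (P : pred I) (F : I -> 'M[C]_(p, q)) :
  (\sum_(i <- s | P i) F i)^H = \sum_(i <- s | P i) (F i)^H.
Proof. by rewrite linear_sum /= raddf_sum. Qed.

Lemma trmxC_scalar n (c : C) : (c%:M : 'M_n)^H = c^*%:M.
Proof. by rewrite tr_scalar_mx map_scalar_mx. Qed.

Lemma trmxC1 n : (1%:M : 'M[C]_n)^H = 1%:M.
Proof. by rewrite trmxC_scalar rmorph1. Qed.

Lemma trmxC_tens p q r s (A : 'M[C]_(p, q)) (B : 'M[C]_(r, s)) :
  (A *t B)^H = A^H *t B^H.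
Proof. by rewrite trmx_tens map_mxT. Qed.

Lemma hermP n (A : 'M[C]_n) : reflect (A^H = A) (A \is hermsymmx).
Proof.
by apply: (iffP (is_hermitianmxP _ _ _)); rewrite expr0 scale1r; move/esym.
Qed.

Definition dot n (u v : 'cV[C]_n) : C := (u^H *m v) 0 0.
Definition sqn n (u : 'cV[C]_n) : C := dot u u.

(** Twice the real part of the scalar product. *)
Definition rdot n (u v : 'cV[C]_n) : C := dot u v + dot v u.

Section Dot.
Variable n : nat.
Implicit Types u v w : 'cV[C]_n.

Lemma dotE u v : dot u v = \sum_i (u i 0)^* * v i 0.
Proof. by rewrite /dot mxE; apply: eq_bigr => i _; rewrite !mxE. Qed.

Lemma sqnE u : sqn u = \sum_i `|u i 0| ^+ 2.
Proof. by rewrite /sqn dotE; apply: eq_bigr => i _; rewrite mulrC -normCK. Qed.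

Lemma dotC u v : (dot u v)^* = dot v u.
Proof.
rewrite !dotE rmorph_sum; apply: eq_bigr => i _.
by rewrite rmorphM /= conjCK mulrC.
Qed.

Lemma dotDl u v w : dot (u + v) w = dot u w + dot v w.
Proof. by rewrite /dot trmxCD mulmxDl mxE. Qed.

Lemma dotDr u v w : dot u (v + w) = dot u v + dot u w.
Proof. by rewrite /dot mulmxDr mxE. Qed.

Lemma dotZl c u v : dot (c *: u) v = c^* * dot u v.
Proof. by rewrite /dot trmxCZ -scalemxAl mxE. Qed.

Lemma dotZr c u v : dot u (c *: v) = c * dot u v.
Proof. by rewrite /dot -scalemxAr mxE. Qed.

Lemma dot0r u : dot u 0 = 0.
Proof. by rewrite /dot mulmx0 mxE. Qed.

Lemma dot0l u : dot 0 u = 0.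
Proof. by rewrite -dotC dot0r rmorph0. Qed.

Lemma dot_sumr I (s : seq I) (P : pred I) u (F : I -> 'cV[C]_n) :
  dot u (\sum_(i <- s | P i) F i) = \sum_(i <- s | P i) dot u (F i).
Proof. by rewrite /dot mulmx_sumr summxE. Qed.

Lemma sqn_ge0 u : 0 <= sqn u.
Proof. by rewrite sqnE; apply: sumr_ge0 => i _; rewrite exprn_ge0. Qed.

Lemma sqn_eq0 u : sqn u = 0 -> u = 0.
Proof.
rewrite sqnE => /eqP; rewrite psumr_eq0; last by move=> i _; rewrite exprn_ge0.
move=> /allP h; apply/matrixP => i j; rewrite ord1 mxE.
by have := h i (mem_index_enum i); rewrite /= expf_eq0 /= normr_eq0 => /eqP.
Qed.

Lemma sqnZ c u : sqn (c *: u) = `|c| ^+ 2 * sqn u.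
Proof. by rewrite /sqn dotZl dotZr mulrA normCK [c * _]mulrC. Qed.

Lemma sqnD u v : sqn (u + v) = sqn u + sqn v + rdot u v.
Proof. by rewrite /sqn /rdot !dotDl !dotDr; ring. Qed.

Lemma rdot_le u v : rdot u v <= sqn u + sqn v.
Proof.
have := sqn_ge0 (u + (- 1) *: v).
rewrite sqnD sqnZ normrN1 expr1n mul1r /rdot dotZr dotZl rmorphN1 !mulN1r.
by rewrite -opprD subr_ge0.
Qed.

End Dot.

Lemma dot_adj p q (A : 'M[C]_(p, q)) u v : dot u (A *m v) = dot (A^H *m u) v.
Proof. by rewrite /dot trmxCM trmxCK mulmxA. Qed.

Lemma dot_adjl p q (A : 'M[C]_(p, q)) u v : dot (A *m u) v = dot u (A^H *m v).
Proof. by rewrite dot_adj trmxCK. Qed.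

Lemma sqn_isom p q (V : 'M[C]_(p, q)) u : V^H *m V = 1%:M ->
  sqn (V *m u) = sqn u.
Proof. by move=> h; rewrite /sqn dot_adjl mulmxA h mul1mx. Qed.

Definition normle (c : C) p q (X : 'M[C]_(p, q)) : Prop :=
  forall v, sqn (X *m v) <= c ^+ 2 * sqn v.

(** In contrast to [normle] this condition is linear in [X], and symmetric under
[X |-> X^H]; for [c >= 0] the two agree. *)
Definition formle (c : C) p q (X : 'M[C]_(p, q)) : Prop :=
  forall u v, rdot u (X *m v) <= c * (sqn u + sqn v).

(** From left to right this is [2 Re <c u, X v> <= |c u|^2 + |X v|^2], divided by
[c]; from right to left, the choice [u = c^-1 X v]. *)
Lemma normle_formle c p q (X : 'M[C]_(p, q)) : 0 <= c -> normle c X <-> formle c X.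
Proof.
rewrite le_eqVlt => /predU1P[<-|c0]; split=> h.
- move=> u v; have := h v; rewrite expr0n mul0r mul0r => h0.
  have -> : X *m v = 0 by apply: sqn_eq0; apply/eqP; rewrite eq_le h0 sqn_ge0.
  by rewrite /rdot dot0r dot0l addr0.
- move=> v; have := h (X *m v) v; rewrite /rdot expr0n !mul0r -mulr2n.
  by rewrite pmulrn_lle0.
- move=> u v; have := rdot_le (c *: u) (X *m v).
  have cr : c^* = c by apply/CrealP/gtr0_real.
  rewrite /rdot dotZl dotZr cr sqnZ -mulrDr => le1.
  rewrite -(ler_pM2l c0); apply: (le_trans le1).
  rewrite mulrA -expr2 mulrDr ger0_norm ?(ltW c0) //.
  by rewrite lerD2l h.
- move=> v; have := h (c^-1 *: (X *m v)) v.
  have cr : c^-1^* = c^-1 by apply/CrealP; rewrite realV gtr0_real.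
  have e : rdot (c^-1 *: (X *m v)) (X *m v) = 2 * c^-1 * sqn (X *m v).
    by rewrite /rdot dotZl dotZr cr /sqn; ring.
  rewrite e sqnZ ger0_norm ?invr_ge0 ?(ltW c0) // => le1.
  have cn : c != 0 by rewrite gt_eqF.
  move: le1; rewrite -(ler_pM2l c0).
  have -> : c * (2 / c * sqn (X *m v)) = sqn (X *m v) + sqn (X *m v) by field.
  have -> : c * (c * (c^-1 ^+ 2 * sqn (X *m v) + sqn v)) =
            sqn (X *m v) + c ^+ 2 * sqn v by field.
  by rewrite lerD2l.
Qed.

Lemma normle_adj (c : C) p q (X : 'M[C]_(p, q)) : 0 <= c -> normle c X -> normle c X^H.
Proof.
move=> c0 /(normle_formle _ c0) h; apply/(normle_formle _ c0) => u v.
rewrite /rdot dot_adjl trmxCK dot_adj trmxCK addrC [in leRHS]addrC.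
exact: h.
Qed.

(** * Positive semidefinite matrices *)

(** Over [R[i]] this is [psdmx] up to conversion. *)
Definition psd n (A : 'M[C]_n) : Prop :=
  A \is hermsymmx /\ forall v : 'cV[C]_n, 0 <= (v^H *m A *m v) 0 0.

Lemma psdP n (A : 'M[C]_n) :
  psd A <-> A^H = A /\ forall v, 0 <= dot v (A *m v).
Proof.
by split=> -[/hermP h1 h2]; split=> // v; have := h2 v; rewrite /dot mulmxA.
Qed.

Lemma psd_herm n (A : 'M[C]_n) : psd A -> A^H = A.
Proof. by case/psdP. Qed.

Lemma psd_ge0 n (A : 'M[C]_n) v : psd A -> 0 <= dot v (A *m v).
Proof. by case/psdP. Qed.

Lemma psd_gram p n (S : 'M[C]_(p, n)) : psd (S^H *m S).
Proof.
apply/psdP; rewrite trmxCM trmxCK; split=> // v.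
by rewrite -mulmxA -dot_adjl; apply: sqn_ge0.
Qed.

Lemma psd1 n : psd (1%:M : 'M[C]_n).
Proof. by rewrite -[1%:M]mulmx1 -{1}(trmxC1 n); apply: psd_gram. Qed.

Lemma psd0 n : psd (0 : 'M[C]_n).
Proof. by have := psd_gram (0 : 'M[C]_n); rewrite mulmx0. Qed.

Lemma psdD n (A B : 'M[C]_n) : psd A -> psd B -> psd (A + B).
Proof.
move=> /psdP[hA pA] /psdP[hB pB]; apply/psdP; rewrite trmxCD hA hB; split=> // v.
by rewrite mulmxDl dotDr addr_ge0.
Qed.

Lemma psd_sum n I (s : seq I) (P : pred I) (F : I -> 'M[C]_n) :
  (forall i, P i -> psd (F i)) -> psd (\sum_(i <- s | P i) F i).
Proof. by move=> h; apply: (big_ind (@psd n)) => //; [apply: psd0 | apply: psdD]. Qed.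

Lemma psdZ n (c : C) (A : 'M[C]_n) : 0 <= c -> psd A -> psd (c *: A).
Proof.
move=> c0 /psdP[hA pA]; apply/psdP; split=> [|v].
  by rewrite trmxCZ hA; congr (_ *: _); apply/CrealP/ger0_real.
by rewrite -scalemxAl dotZr mulr_ge0.
Qed.

Lemma psd_congr p n (S : 'M[C]_(p, n)) A : psd A -> psd (S^H *m A *m S).
Proof.
move=> /psdP[hA pA]; apply/psdP; rewrite !trmxCM trmxCK hA mulmxA; split=> // v.
by rewrite -!mulmxA -dot_adjl.
Qed.

(** The spectral theorem, with the inverse of the unitary as an adjoint. *)
Lemma spectral n (A : 'M[C]_n) : A *m A^H = A^H *m A ->
  exists (P : 'M[C]_n) (d : 'rV[C]_n),
    [/\ P *m P^H = 1%:M, P^H *m P = 1%:M & A = P^H *m diag_mx d *m P].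
Proof.
move=> /normalmxP/orthomx_spectralP e.
have PU := spectral_unitarymx A.
have PP : spectralmx A *m (spectralmx A)^H = 1%:M by apply/unitarymxP.
exists (spectralmx A), (spectral_diag A); split=> //; first exact: mulmx1C.
by rewrite -invmx_unitary.
Qed.

Lemma spectral_eigen n (P : 'M[C]_n) d i : P *m P^H = 1%:M ->
  let v := P^H *m delta_mx i 0 in
  (P^H *m diag_mx d *m P) *m v = d 0 i *: v /\ sqn v = 1.
Proof.
move=> PP v; split.
  rewrite /v mulmxA -(mulmxA _ P) PP mulmx1 -mulmxA.
  rewrite scalemxAr; congr (_ *m _); apply/matrixP=> a b.
  rewrite mul_diag_mx !mxE ord1 andbT.
  by case: eqP => [->|_]; rewrite ?mulr0.
rewrite /v sqn_isom ?trmxCK // sqnE (bigD1 i) //= big1 ?addr0.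
  by rewrite mxE !eqxx normr1 expr1n.
by move=> j ji; rewrite mxE (negPf ji) normr0 expr0n.
Qed.

(** The square root of the spectral diagonal gives [S]. *)
Lemma psd_factor n (A : 'M[C]_n) : psd A -> exists S : 'M_n, A = S^H *m S.
Proof.
move=> psdA; have /psdP[hA pA] := psdA.
have [|P [d [PP P'P eA]]] := @spectral _ A; first by rewrite hA.
have d0 i : 0 <= d 0 i.
  have [ev nv] := spectral_eigen d i PP.
  by have := pA (P^H *m delta_mx i 0); rewrite eA ev dotZr -/(sqn _) nv mulr1.
pose s : 'rV_n := \row_i sqrtC (d 0 i).
exists (diag_mx s *m P); rewrite trmxCM mulmxA -(mulmxA _ _ (diag_mx s)) eA.
congr (_ *m _ *m _); apply/matrixP => i j.
rewrite mul_mx_diag !mxE eq_sym; case: eqP => [->|_]; last first.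
  by rewrite !mulr0n rmorph0 mul0r.
rewrite !mulr1n (CrealP _) ?ger0_real ?sqrtC_ge0 //.
by rewrite -expr2 sqrtCK.
Qed.

Lemma psd_tens p q (A : 'M[C]_p) (B : 'M[C]_q) :
  psd A -> psd B -> psd (A *t B).
Proof.
move=> /psd_factor[S ->] /psd_factor[T ->].
by rewrite -tensmx_mul -trmxC_tens; apply: psd_gram.
Qed.

(** * Contractions as unimodular combinations of positive matrices *)

(** The [Q i] form a positive operator valued measure, of which [y] is an
integral of a function with values in the unit circle. *)
Definition povm_comb n (y : 'M[C]_n) : Prop :=
  exists (I : finType) (l : I -> C) (Q : I -> 'M[C]_n),
  [/\ forall i, `|l i| = 1, forall i, psd (Q i),
      \sum_i Q i = 1%:M & \sum_i l i *: Q i = y].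

(** The [Q i] are the rank one projections on an orthonormal eigenbasis. *)
Lemma povm_unitary n (U : 'M[C]_n) : U *m U^H = 1%:M -> povm_comb U.
Proof.
move=> UU; have U'U : U^H *m U = 1%:M by apply: mulmx1C.
have [|P [d [PP P'P eU]]] := @spectral _ U; first by rewrite UU U'U.
exists 'I_n, (fun i => d 0 i), (fun i => (row i P)^H *m row i P); split.
- move=> i; have [ev nv] := spectral_eigen d i PP.
  have := sqn_isom (P^H *m delta_mx i 0) U'U.
  rewrite {1}eU ev sqnZ nv mulr1 => /eqP.
  by rewrite sqrp_eq1 ?normr_ge0 // => /eqP.
- by move=> i; apply: psd_gram.
- rewrite -P'P; apply/matrixP => a b; rewrite summxE !mxE.
  by apply: eq_bigr => i _; rewrite !mxE big_ord1 !mxE.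
- rewrite eU; apply/matrixP => a b; rewrite summxE mul_mx_diag !mxE.
  apply: eq_bigr => i _; rewrite !mxE big_ord1 !mxE; ring.
Qed.

Lemma povm_mean n (x y : 'M[C]_n) :
  povm_comb x -> povm_comb y -> povm_comb (2^-1 *: (x + y)).
Proof.
move=> [I [l [Q [l1 pQ sQ eQ]]]] [J [l' [Q' [l1' pQ' sQ' eQ']]]].
exists (I + J)%type, (fun k => match k with inl i => l i | inr j => l' j end).
exists (fun k => 2^-1 *: match k with inl i => Q i | inr j => Q' j end).
split=> [[i|j]|[i|j]||] //.
- by apply: psdZ; rewrite ?invr_ge0 ?ler0n.
- by apply: psdZ; rewrite ?invr_ge0 ?ler0n.
- rewrite -scaler_sumr big_sumType /= sQ sQ' -mulr2n -scaler_nat scalerA.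
  by rewrite mulVf ?scale1r // pnatr_eq0.
- under eq_bigr do rewrite scalerA mulrC -scalerA.
  by rewrite -scaler_sumr big_sumType /= eQ eQ'.
Qed.

Lemma povm_compress p n (V : 'M[C]_(p, n)) (x : 'M[C]_p) :
  V^H *m V = 1%:M -> povm_comb x -> povm_comb (V^H *m x *m V).
Proof.
move=> VV [I [l [Q [l1 pQ sQ eQ]]]].
exists I, l, (fun i => V^H *m Q i *m V); split=> // [i||].
- exact: psd_congr.
- by rewrite -mulmx_suml -mulmx_sumr sQ mulmx1.
- rewrite -eQ mulmx_sumr mulmx_suml; apply: eq_bigr => i _.
  by rewrite -scalemxAr -scalemxAl.
Qed.

Lemma sqn_col_mx p q (a : 'cV[C]_p) (b : 'cV[C]_q) :
  sqn (col_mx a b) = sqn a + sqn b.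
Proof.
rewrite !sqnE big_split_ord /=.
by congr (_ + _); apply: eq_bigr => i _; rewrite ?col_mxEu ?col_mxEd.
Qed.

Lemma trmxC_block p q r s (a : 'M[C]_(p, q)) (b : 'M_(p, r)) (c : 'M_(s, q))
  (d : 'M_(s, r)) : (block_mx a b c d)^H = block_mx a^H c^H b^H d^H.
Proof. by rewrite tr_block_mx map_block_mx. Qed.

(** [h] is the mean of the unitaries [h + i s] and [h - i s] with
[s = sqrt (1 - h^2)], built on the spectral diagonal of [h]. *)
Lemma povm_hermitian_contraction n (h U : 'M[C]_n) :
  h^H = h -> normle 1 h -> U *m U^H = 1%:M -> povm_comb (h *m U).
Proof.
move=> hh ch UU; have [|P [d [PP P'P eh]]] := @spectral _ h; first by rewrite hh.
have d1 i : `|d 0 i| <= 1.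
  have [ev nv] := spectral_eigen d i PP.
  have := ch (P^H *m delta_mx i 0); rewrite eh ev sqnZ nv expr1n !mulr1.
  by rewrite -[leRHS](expr1n _ 2) ler_pXn2r ?nnegrE.
have dr i : (d 0 i)^* = d 0 i.
  have [ev nv] := spectral_eigen d i PP.
  have := dotC (P^H *m delta_mx i 0) (h *m (P^H *m delta_mx i 0)).
  by rewrite (dot_adjl h) hh eh ev dotZr -/(sqn _) nv mulr1.
pose s i := sqrtC (1 - d 0 i ^+ 2).
have sE i : s i ^+ 2 = 1 - d 0 i ^+ 2 by rewrite sqrtCK.
have sr i : (s i)^* = s i.
  apply/CrealP/ger0_real; rewrite sqrtC_ge0 subr_ge0.
  have -> : d 0 i ^+ 2 = `|d 0 i| ^+ 2 by rewrite normCK dr expr2.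
  by rewrite expr_le1.
pose e : 'rV_n := \row_i (d 0 i + 'i * s i).
pose W := P^H *m diag_mx e *m P.
(* The diagonal entries of [W] lie on the unit circle, above those of [h]. *)
have eW : h = 2^-1 *: (W + W^H).
  rewrite /W !trmxCM trmxCK mulmxA -mulmxDl -mulmxDr scalemxAl scalemxAr eh.
  congr (_ *m _ *m _); apply/matrixP=> i j; rewrite !mxE eq_sym.
  case: eqP => [->|_]; last by rewrite !mulr0n rmorph0 addr0 mulr0.
  by rewrite !mulr1n rmorphD rmorphM /= dr sr conjCi; field.
have WW : W *m W^H = 1%:M.
  rewrite /W !trmxCM trmxCK !mulmxA -(mulmxA _ P) PP mulmx1 -(mulmxA P^H).
  have -> : diag_mx e *m (diag_mx e)^H = 1%:M.
    apply/matrixP => i j; rewrite mul_diag_mx !mxE eq_sym.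
    case: eqP => [->|_]; last by rewrite mulr0n rmorph0 mulr0.
    rewrite mulr1n rmorphD rmorphM /= dr sr conjCi.
    have := sE j; have := sqrCi C; move: 'i (s j) (d 0 j) => w s0 d0 w2 s2.
    transitivity (d0 ^+ 2 - w ^+ 2 * s0 ^+ 2); first by ring.
    by rewrite w2 s2; ring.
  by rewrite mulmx1.
move: W eW WW => W -> WW.
rewrite -scalemxAl mulmxDl; apply: povm_mean; apply: povm_unitary.
  by rewrite trmxCM mulmxA -(mulmxA W) UU mulmx1.
by rewrite trmxCM mulmxA -(mulmxA W^H) UU mulmx1 trmxCK mulmx1C.
Qed.

(** [y] is the compression to the first [n] coordinates of [h s], where
[h = [0 y; y* 0]] is a hermitian contraction and [s] exchanges the halves.  The
factor [s] moves [y] to the diagonal, where one isometry [V] serves both sides,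
as a compression requires. *)
Lemma povm_contraction n (y : 'M[C]_n) : normle 1 y -> povm_comb y.
Proof.
move=> cy; pose h : 'M_(n + n) := block_mx 0 y y^H 0.
pose s : 'M[C]_(n + n) := block_mx 0 1%:M 1%:M 0.
pose V : 'M[C]_(n + n, n) := col_mx 1%:M 0.
have VH : V^H = row_mx 1%:M 0.
  by rewrite tr_col_mx map_row_mx trmxC1 trmx0 map_mx0.
have -> : y = V^H *m (h *m s) *m V.
  rewrite VH mulmx_block mul_row_block mul_row_col.
  by rewrite !(mul0mx, mulmx0, mul1mx, mulmx1, add0r, addr0).
apply: povm_compress; first by rewrite VH mul_row_col mulmx1 mulmx0 addr0.
apply: povm_hermitian_contraction.
- by rewrite trmxC_block trmxCK trmx0 map_mx0.
- move=> v; rewrite expr1n mul1r -[v]vsubmxK mul_block_col !mul0mx add0r addr0.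
  rewrite !sqn_col_mx [leRHS]addrC; apply: lerD.
    by have := cy (dsubmx v); rewrite expr1n mul1r.
  by have := normle_adj ler01 cy (usubmx v); rewrite expr1n mul1r.
- rewrite trmxC_block trmxC1 trmx0 map_mx0 mulmx_block.
  rewrite !(mul0mx, mulmx0, mul1mx, mulmx1, add0r, addr0).
  by rewrite -scalar_mx_block.
Qed.

End Vectors.

(** * Tensor products *)

Lemma sum_tens (V : nmodType) p q (F : 'I_(p * q) -> V) :
  \sum_x F x = \sum_i \sum_a F (mxtens_index (i, a)).
Proof.
rewrite pair_big /= (reindex (@mxtens_index p q)) /=.
  by apply: eq_bigr => -[i a] _.
by exists (@mxtens_unindex p q) => x _; rewrite (mxtens_indexK, mxtens_unindexK).
Qed.

Lemma eq_mxtens (T : Type) p q r s (A B : 'M[T]_(p * q, r * s)) :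
  (forall i a j b, A (mxtens_index (i, a)) (mxtens_index (j, b)) =
                   B (mxtens_index (i, a)) (mxtens_index (j, b))) -> A = B.
Proof.
move=> h; apply/matrixP => x y.
by case: (mxtens_indexP x) (mxtens_indexP y) => i a [j b].
Qed.

Section TensC.
Variable C : numClosedFieldType.

Lemma tensmxDl p q r s (A A' : 'M[C]_(p, q)) (B : 'M[C]_(r, s)) :
  (A + A') *t B = A *t B + A' *t B.
Proof. by apply/matrixP => i j; rewrite !mxE mulrDl. Qed.

Lemma tensmxDr p q r s (A : 'M[C]_(p, q)) (B B' : 'M[C]_(r, s)) :
  A *t (B + B') = A *t B + A *t B'.
Proof. by apply/matrixP => i j; rewrite !mxE mulrDr. Qed.

Lemma tensmxZl c p q r s (A : 'M[C]_(p, q)) (B : 'M[C]_(r, s)) :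
  (c *: A) *t B = c *: (A *t B).
Proof. by apply/matrixP => i j; rewrite !mxE mulrA. Qed.

Lemma tensmxZr c p q r s (A : 'M[C]_(p, q)) (B : 'M[C]_(r, s)) :
  A *t (c *: B) = c *: (A *t B).
Proof. by apply/matrixP => i j; rewrite !mxE mulrCA. Qed.

Lemma tensmx_suml I (e : seq I) (P : pred I) p q r s (F : I -> 'M[C]_(p, q))
  (B : 'M[C]_(r, s)) :
  (\sum_(i <- e | P i) F i) *t B = \sum_(i <- e | P i) F i *t B.
Proof.
elim/big_rec2: _ => [|i Y X _ <-]; first exact: tens0mx.
by rewrite tensmxDl.
Qed.

Lemma tensmx_sumr I (e : seq I) (P : pred I) p q r s (F : I -> 'M[C]_(p, q))
  (B : 'M[C]_(r, s)) :
  B *t (\sum_(i <- e | P i) F i) = \sum_(i <- e | P i) B *t F i.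
Proof.
elim/big_rec2: _ => [|i Y X _ <-]; first exact: tensmx0.
by rewrite tensmxDr.
Qed.

Lemma tensmx11 p q : 1%:M *t 1%:M = 1%:M :> 'M[C]_(p * q).
Proof.
apply: eq_mxtens => i a j b; rewrite tensmxE !mxE.
rewrite (can_eq (@mxtens_indexK p q)) xpair_eqE -natrM mulnb //.
Qed.

Definition tensv p q (u : 'cV[C]_p) (x : 'cV[C]_q) : 'cV[C]_(p * q) :=
  \col_k (u (mxtens_unindex k).1 0 * x (mxtens_unindex k).2 0).

Lemma tensvE p q (u : 'cV[C]_p) (x : 'cV[C]_q) i a :
  tensv u x (mxtens_index (i, a)) 0 = u i 0 * x a 0.
Proof. by rewrite mxE mxtens_indexK. Qed.

Lemma sqn_tensv p q (u : 'cV[C]_p) (x : 'cV[C]_q) :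
  sqn (tensv u x) = sqn u * sqn x.
Proof.
rewrite !sqnE sum_tens mulr_suml; apply: eq_bigr => i _.
rewrite mulr_sumr; apply: eq_bigr => a _.
by rewrite tensvE normrM exprMn.
Qed.

(** The partial scalar product [(u* (x) 1) X (w (x) 1)]. *)
Definition slice p q (X : 'M[C]_(p * q)) (u w : 'cV[C]_p) : 'M[C]_q :=
  \matrix_(a, b) \sum_i \sum_j
     (u i 0)^* * X (mxtens_index (i, a)) (mxtens_index (j, b)) * w j 0.

Lemma dot_slice p q (X : 'M[C]_(p * q)) u w x y :
  dot x (slice X u w *m y) = dot (tensv u x) (X *m tensv w y).
Proof.
rewrite !dotE sum_tens exchange_big /=; apply: eq_bigr => a _.
have -> : (slice X u w *m y) a 0 = \sum_b \sum_i \sum_j (u i 0)^* *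
    X (mxtens_index (i, a)) (mxtens_index (j, b)) * w j 0 * y b 0.
  rewrite mxE; apply: eq_bigr => b _; rewrite mxE mulr_suml.
  by apply: eq_bigr => i _; rewrite mulr_suml.
rewrite exchange_big mulr_sumr; apply: eq_bigr => i _ /=.
rewrite tensvE rmorphM /= [_ * (x a 0)^*]mulrC -[RHS]mulrA; congr (_ * _).
rewrite mxE sum_tens exchange_big /= mulr_sumr; apply: eq_bigr => b _.
rewrite mulr_sumr; apply: eq_bigr => j _.
by rewrite tensvE; ring.
Qed.

(** The norm is at most [|u| |w|], which the arithmetic mean of the squares
bounds without square roots.  In [formle] at [u (x) x] and [w (x) v], the best
choice of [x] is a multiple of [Z v]. *)
Lemma normle_slice p q (X : 'M[C]_(p * q)) u w :
  normle 1 X -> normle (2^-1 * (sqn u + sqn w)) (slice X u w).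
Proof.
move=> /(normle_formle _ ler01) h v.
have u0 := sqn_ge0 u; have w0 := sqn_ge0 w; have v0 := sqn_ge0 v.
set Z := slice X u w; set N := sqn _.
have N0 : 0 <= N by apply: sqn_ge0.
have le2 : sqn u * (sqn w * sqn v) <= (2^-1 * (sqn u + sqn w)) ^+ 2 * sqn v.
  rewrite -subr_ge0.
  have -> : (2^-1 * (sqn u + sqn w)) ^+ 2 * sqn v - sqn u * (sqn w * sqn v) =
     (2^-1 * (sqn u - sqn w)) ^+ 2 * sqn v by field.
  apply: mulr_ge0 => //; apply: real_exprn_even_ge0 => //.
  by rewrite realM ?realV ?realB ?ger0_real ?ler0n.
apply: le_trans le2.
case: (eqVneq (sqn u) 0) => [/sqn_eq0 uE|un0].
  rewrite /N /Z.
  have -> : slice X u w = 0.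
    apply/matrixP => a b; rewrite !mxE big1 // => i _; rewrite big1 // => j _.
    by rewrite uE mxE rmorph0 !mul0r.
  by rewrite mul0mx /sqn dot0r !mulr_ge0 // sqn_ge0.
have ugt0 : 0 < sqn u by rewrite lt_def un0.
have := h (tensv u ((sqn u)^-1 *: (Z *m v))) (tensv w v).
have cr : (sqn u)^-1^* = (sqn u)^-1 by apply/CrealP; rewrite realV ger0_real.
rewrite /rdot -dot_slice -(dotC (tensv u _)) -dot_slice !dotZl cr rmorphM /= cr.
rewrite dotC -/(sqn _) -/N !sqn_tensv sqnZ -/N ger0_norm ?invr_ge0 //.
rewrite -(ler_pM2l ugt0).
have -> : sqn u * ((sqn u)^-1 * N + (sqn u)^-1 * N) = N + N by field.
have -> : sqn u * (1 * (sqn u * ((sqn u)^-1 ^+ 2 * N) + sqn w * sqn v)) =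
  N + sqn u * (sqn w * sqn v) by field.
by rewrite lerD2l.
Qed.

Definition tens_swap p q (x : 'I_(q * p)) : 'I_(p * q) :=
  mxtens_index ((mxtens_unindex x).2, (mxtens_unindex x).1).

Lemma tens_swapK p q : cancel (@tens_swap p q) (@tens_swap q p).
Proof. by move=> x; rewrite /tens_swap mxtens_indexK; apply: mxtens_unindexK. Qed.

Definition swapmx p q (X : 'M[C]_(p * q)) : 'M[C]_(q * p) :=
  mxsub (@tens_swap p q) (@tens_swap p q) X.

Lemma swapmx_tens p q (A : 'M[C]_p) (B : 'M[C]_q) : swapmx (A *t B) = B *t A.
Proof. by apply/matrixP => x y; rewrite !mxE !mxtens_indexK mulrC. Qed.

Lemma swapmx_herm p q (X : 'M[C]_(p * q)) : X^H = X -> (swapmx X)^H = swapmx X.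
Proof. by move=> h; apply/matrixP => x y; rewrite -{2}h !mxE. Qed.

Lemma normle_swap c p q (X : 'M[C]_(p * q)) : normle c X -> normle c (swapmx X).
Proof.
move=> h v; have := h (rowsub (@tens_swap q p) v); congr (_ <= _ * _).
  rewrite !sqnE (reindex (@tens_swap p q)) /=; last first.
    by exists (@tens_swap q p) => x _; apply: tens_swapK.
  apply: eq_bigr => x _; rewrite !mxE; congr (`|_| ^+ 2).
  rewrite (reindex (@tens_swap p q)) /=; last first.
    by exists (@tens_swap q p) => y _; apply: tens_swapK.
  by apply: eq_bigr => y _; rewrite !mxE tens_swapK.
rewrite !sqnE (reindex (@tens_swap p q)) /=; last first.
  by exists (@tens_swap q p) => x _; apply: tens_swapK.
by apply: eq_bigr => x _; rewrite !mxE tens_swapK.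
Qed.

(** The Gram matrix of [e_a - l e_b], also when [a = b]. *)
Lemma delta_gram n (a b : 'I_n) (l : C) : `|l| = 1 ->
  psd (delta_mx a a + delta_mx b b - l *: delta_mx a b - l^* *: delta_mx b a).
Proof.
move=> l1; pose v : 'rV[C]_n := delta_mx 0 a - l *: delta_mx 0 b.
have dd (i j : 'I_n) : (delta_mx 0 i : 'rV[C]_n)^H *m delta_mx 0 j = delta_mx i j.
  by rewrite trmx_delta map_delta_mx mul_delta_mx.
have ll : l^* * l = 1 by rewrite mulrC -normCK l1 expr1n.
suff -> : delta_mx a a + delta_mx b b - l *: delta_mx a b - l^* *: delta_mx b a
   = v^H *m v by apply: psd_gram.
rewrite /v trmxCB trmxCZ mulmxBl !mulmxBr -!scalemxAl -!scalemxAr !dd scalerA ll scale1r.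
by apply/matrixP => i j; rewrite !mxE; ring.
Qed.

Lemma sqn_delta p (i : 'I_p) : sqn (delta_mx i 0 : 'cV[C]_p) = 1.
Proof.
rewrite sqnE (bigD1 i) //= big1 ?addr0; first by rewrite mxE !eqxx normr1 expr1n.
by move=> j /negPf ij; rewrite mxE ij normr0 expr0n.
Qed.

(** * Separable elements near the identity *)

(** Over [R[i]] this is [separable] up to conversion. *)
Definition tens_cone p q (X : 'M[C]_(p * q)) : Prop :=
  exists (N : nat) (P : 'I_N -> 'M[C]_p) (Q : 'I_N -> 'M[C]_q),
    (forall i, psd (P i) /\ psd (Q i)) /\ X = \sum_i P i *t Q i.

(** Over [R[i]] this is [tens_block] up to conversion. *)
Definition blockmx p q (X : 'M[C]_(p * q)) (i j : 'I_p) : 'M[C]_q :=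
  \matrix_(a, b) X (mxtens_index (i, a)) (mxtens_index (j, b)).

Lemma tens_cone_tens p q (A : 'M[C]_p) (B : 'M[C]_q) :
  psd A -> psd B -> tens_cone (A *t B).
Proof.
by move=> pA pB; exists 1%N, (fun=> A), (fun=> B); rewrite big_ord1.
Qed.

Lemma tens_cone0 p q : tens_cone (0 : 'M[C]_(p * q)).
Proof.
by exists 0%N, (fun=> 0), (fun=> 0); split=> [[]//|]; rewrite big_ord0.
Qed.

Lemma tens_coneD p q (X Y : 'M[C]_(p * q)) :
  tens_cone X -> tens_cone Y -> tens_cone (X + Y).
Proof.
move=> [N [P [Q [h ->]]]] [N' [P' [Q' [h' ->]]]].
exists (N + N')%N.
exists (fun k => match split k with inl i => P i | inr j => P' j end).
exists (fun k => match split k with inl i => Q i | inr j => Q' j end).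
split=> [i|]; first by case: (split i).
rewrite big_split_ord /=; congr (_ + _); apply: eq_bigr => i _.
  by rewrite (unsplitK (inl i)).
by rewrite (unsplitK (inr i)).
Qed.

Lemma tens_cone_sum p q I (s : seq I) (P : pred I) (F : I -> 'M[C]_(p * q)) :
  (forall i, P i -> tens_cone (F i)) -> tens_cone (\sum_(i <- s | P i) F i).
Proof.
by move=> h; apply: (big_ind (@tens_cone p q)) => //;
  [apply: tens_cone0 | apply: tens_coneD].
Qed.

Lemma tens_coneZ p q (c : C) (X : 'M[C]_(p * q)) :
  0 <= c -> tens_cone X -> tens_cone (c *: X).
Proof.
move=> c0 [N [P [Q [h ->]]]]; rewrite scaler_sumr; apply: tens_cone_sum => i _.
rewrite -tensmxZl; have [hP hQ] := h i.
exact: tens_cone_tens (psdZ c0 hP) hQ.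
Qed.

Lemma tens_cone_swap p q (X : 'M[C]_(p * q)) :
  tens_cone X -> tens_cone (swapmx X).
Proof.
move=> [N [P [Q [h ->]]]]; rewrite /swapmx.
have -> : mxsub (@tens_swap p q) (@tens_swap p q) (\sum_i P i *t Q i) =
   \sum_i swapmx (P i *t Q i).
  by apply/matrixP => x y; rewrite mxE !summxE; apply: eq_bigr => i _; rewrite !mxE.
apply: tens_cone_sum => i _; rewrite swapmx_tens.
by have [hP hQ] := h i; apply: tens_cone_tens.
Qed.

Lemma blockmxE p q (X : 'M[C]_(p * q)) i j :
  blockmx X i j = slice X (delta_mx i 0) (delta_mx j 0).
Proof.
apply/matrixP => a b; rewrite !mxE (bigD1 i) //= [X in _ = _ + X]big1 ?addr0.
  rewrite (bigD1 j) //= big1 ?addr0; first by rewrite !mxE !eqxx rmorph1 mul1r mulr1.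
  by move=> j' /negPf jj; rewrite [delta_mx j 0 _ _]mxE jj mulr0.
move=> i' /negPf ii; rewrite big1 // => j' _.
by rewrite [delta_mx i 0 _ _]mxE ii rmorph0 !mul0r.
Qed.

Lemma blockmxK p q (X : 'M[C]_(p * q)) :
  X = \sum_i \sum_j delta_mx i j *t blockmx X i j.
Proof.
apply: eq_mxtens => i a j b; rewrite summxE (bigD1 i) //= summxE (bigD1 j) //=.
rewrite [X in _ = _ + X + _]big1 ?addr0; last first.
  by move=> j' /negPf jj; rewrite tensmxE mxE [j == _]eq_sym jj andbF mul0r.
rewrite big1 ?addr0; first by rewrite tensmxE !mxE !eqxx mul1r.
move=> i' /negPf ii; rewrite summxE big1 // => j' _.
by rewrite tensmxE mxE [i == _]eq_sym ii mul0r.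
Qed.

Lemma normle_block p q (X : 'M[C]_(p * q)) i j :
  normle 1 X -> normle 1 (blockmx X i j).
Proof.
move=> h; rewrite blockmxE.
have := normle_slice (delta_mx i 0) (delta_mx j 0) h.
by rewrite !sqn_delta mulVf // (pnatr_eq0 C 2).
Qed.

(** The terms [G i j] are separable because [blockmx X i j] is a unimodular
combination of positive matrices; each diagonal unit [E_ii] occurs in [2 p] of
them, and hermitian symmetry makes both off-diagonal sums equal to [X]. *)
Lemma tens_cone_contraction_l p q (X : 'M[C]_(p * q)) :
  X^H = X -> normle 1 X -> tens_cone (p%:R *: 1%:M - X).
Proof.
move=> hX cX.
pose G i j := delta_mx i i *t 1%:M + delta_mx j j *t 1%:M -
  delta_mx i j *t blockmx X i j - delta_mx j i *t (blockmx X i j)^H : 'M[C]_(p * q).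
have sG i j : tens_cone (G i j).
  have [I [l [Q [l1 pQ sQ eQ]]]] := povm_contraction (normle_block i j cX).
  have -> : G i j = \sum_k (delta_mx i i + delta_mx j j - l k *: delta_mx i j
     - (l k)^* *: delta_mx j i) *t Q k.
    rewrite /G -sQ -eQ trmxC_sum !tensmx_sumr -big_split -!sumrB /=.
    apply: eq_bigr => k _; rewrite -!scaleN1r !tensmxDl !tensmxZl trmxCZ (psd_herm (pQ k)).
    by rewrite !tensmxZr.
  apply: tens_cone_sum => k _; apply: tens_cone_tens => //.
  exact: delta_gram.
suff -> : p%:R *: 1%:M - X = 2^-1 *: \sum_i \sum_j G i j.
  apply: tens_coneZ; first by rewrite invr_ge0 ler0n.
  by apply: tens_cone_sum => i _; apply: tens_cone_sum => j _.
have s1 : \sum_i delta_mx i i *t 1%:M = 1%:M :> 'M[C]_(p * q).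
  by rewrite -tensmx_suml -tensmx11; congr (_ *t _); rewrite -mx1_sum_delta.
have -> : \sum_i \sum_j G i j = 2 *: (p%:R *: 1%:M - X).
  rewrite /G; under eq_bigr do rewrite !sumrB big_split /=.
  rewrite !sumrB big_split /= exchange_big /= -!blockmxK.
  under eq_bigr do rewrite s1.
  have -> : \sum_i \sum_j delta_mx j i *t (blockmx X i j)^H = X.
    rewrite -[RHS]hX [in RHS](blockmxK X) trmxC_sum; apply: eq_bigr => i _.
    rewrite trmxC_sum; apply: eq_bigr => j _.
    by rewrite trmxC_tens trmx_delta map_delta_mx.
  by rewrite sumr_const card_ord !scaler_nat [RHS]mulr2n [RHS]addrACA addrA.
by rewrite scalerA mulVf ?scale1r // pnatr_eq0.
Qed.

End TensC.

Section Maps.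
Variable C : numClosedFieldType.

Lemma swapmx1 p q : swapmx (1%:M : 'M[C]_(p * q)) = 1%:M.
Proof. by rewrite -[in LHS]tensmx11 swapmx_tens tensmx11. Qed.

Lemma tens_cone_contraction_r p q (X : 'M[C]_(p * q)) :
  X^H = X -> normle 1 X -> tens_cone (q%:R *: 1%:M - X).
Proof.
move=> hX cX.
have := tens_cone_swap (tens_cone_contraction_l (swapmx_herm hX) (normle_swap cX)).
congr tens_cone; rewrite -(swapmx1 q p); apply/matrixP => x y.
by rewrite !mxE !tens_swapK.
Qed.

(** * Amplifications of positive maps *)

Definition posmap n m (Phi : 'M[C]_n -> 'M[C]_m) :=
  forall A, psd A -> psd (Phi A).

(** Over [R[i]] this is [id_tens] up to conversion. *)
Definition ampl k n m (Phi : 'M[C]_n -> 'M[C]_m) (X : 'M[C]_(k * n)) : 'M[C]_(k * m) :=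
  \sum_(i < k) \sum_(j < k) delta_mx i j *t Phi (blockmx X i j).

Section Ampl.
Variables (n m : nat) (Phi : {linear 'M[C]_n -> 'M[C]_m}).

Lemma blockmx_linear k (i j : 'I_k) (X Y : 'M[C]_(k * n)) c :
  blockmx (c *: X + Y) i j = c *: blockmx X i j + blockmx Y i j.
Proof. by apply/matrixP => a b; rewrite !mxE. Qed.

Fact ampl_linear k : linear (@ampl k n m Phi).
Proof.
move=> c X Y; rewrite /ampl scaler_sumr -big_split; apply: eq_bigr => i _ /=.
rewrite scaler_sumr -big_split; apply: eq_bigr => j _ /=.
by rewrite blockmx_linear linearP tensmxDr tensmxZr.
Qed.

HB.instance Definition _ k :=
  GRing.isLinear.Build C 'M[C]_(k * n) 'M[C]_(k * m) _ (@ampl k n m Phi)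
    (@ampl_linear k).

Lemma ampl_tens k (P : 'M[C]_k) Q : ampl Phi (P *t Q) = P *t Phi Q.
Proof.
rewrite /ampl {2}[P]matrix_sum_delta tensmx_suml; apply: eq_bigr => i _.
rewrite tensmx_suml; apply: eq_bigr => j _.
have -> : blockmx (P *t Q) i j = P i j *: Q.
  by apply/matrixP => a b; rewrite mxE tensmxE !mxE.
by rewrite linearZ tensmxZl tensmxZr.
Qed.

Lemma ampl_mul k k' (A : 'M[C]_(k', k)) (B : 'M[C]_(k, k')) X :
  ampl Phi ((A *t 1%:M) *m X *m (B *t 1%:M)) =
  (A *t 1%:M) *m ampl Phi X *m (B *t 1%:M).
Proof.
rewrite {1}(blockmxK X) {2}/ampl !mulmx_sumr !mulmx_suml linear_sum.
apply: eq_bigr => i _; rewrite !mulmx_sumr !mulmx_suml linear_sum.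
apply: eq_bigr => j _; rewrite !tensmx_mul !mulmx1 !mul1mx.
exact: ampl_tens.
Qed.

Lemma amplE k (X : 'M[C]_(k * n)) i j a b :
  ampl Phi X (mxtens_index (i, a)) (mxtens_index (j, b)) =
  Phi (blockmx X i j) a b.
Proof.
rewrite /ampl summxE (bigD1 i) //= summxE (bigD1 j) //=.
rewrite [X in _ + X + _]big1 ?addr0; last first.
  by move=> j' /negPf jj; rewrite tensmxE mxE [j == _]eq_sym jj andbF mul0r.
rewrite big1 ?addr0; first by rewrite tensmxE mxE !eqxx mul1r.
move=> i' /negPf ii; rewrite summxE big1 // => j' _.
by rewrite tensmxE mxE [i == _]eq_sym ii mul0r.
Qed.

Lemma slice_ampl k (X : 'M[C]_(k * n)) u w :
  slice (ampl Phi X) u w = Phi (slice X u w).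
Proof.
have sliceE l (Y : 'M[C]_(k * l)) :
    slice Y u w = \sum_i \sum_j ((u i 0)^* * w j 0) *: blockmx Y i j.
  apply/matrixP => a b; rewrite mxE summxE; apply: eq_bigr => i _.
  rewrite summxE; apply: eq_bigr => j _; rewrite !mxE; ring.
rewrite !sliceE linear_sum; apply: eq_bigr => i _.
rewrite linear_sum; apply: eq_bigr => j _; rewrite linearZ; congr (_ *: _).
by apply/matrixP => a b; rewrite mxE amplE.
Qed.

Hypothesis Phi_pos : posmap Phi.

Lemma ampl_cone k (X : 'M[C]_(k * n)) : tens_cone X -> psd (ampl Phi X).
Proof.
move=> [N [P [Q [h ->]]]]; rewrite linear_sum; apply: psd_sum => i _ /=.
by have [hP hQ] := h i; rewrite ampl_tens; apply: psd_tens => //; apply: Phi_pos.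
Qed.

Hypothesis Phi1_le : psd (1%:M - Phi 1%:M).

(** With [A = \sum_i l_i Q_i], the form of [Phi A] at [(u, w)] is a sum of
[l_i <u, Phi(Q_i) w>], and [Phi(Q_i) >= 0] bounds the real part of each by
half the sum of the forms at [u] and at [w]. *)
Lemma russo_dye A : normle 1 A -> normle 1 (Phi A).
Proof.
move=> cA; apply/(normle_formle _ ler01) => u w.
have [I [l [Q [l1 pQ sQ <-]]]] := povm_contraction cA.
have le1 v : \sum_i dot v (Phi (Q i) *m v) <= sqn v.
  have := psd_ge0 v Phi1_le.
  rewrite mulmxBl mul1mx -scaleN1r dotDr dotZr mulN1r subr_ge0 -/(sqn v).
  by rewrite -sQ linear_sum mulmx_suml dot_sumr.
rewrite mul1r; apply: le_trans (lerD (le1 u) (le1 w)).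
rewrite linear_sum /rdot mulmx_suml dot_sumr -(dotC u) dot_sumr rmorph_sum.
rewrite -!big_split /=; apply: ler_sum => i _.
have [S eS] := psd_factor (Phi_pos (pQ i)).
have := rdot_le (S *m u) (l i *: (S *m w)).
rewrite linearZ /= -scalemxAl eS -!mulmxA !dotZr -!(dot_adjl S).
by rewrite sqnZ l1 expr1n mul1r rmorphM /= dotC /rdot dotZl dotZr.
Qed.

Lemma russo_dye_scaled d A : 0 <= d -> normle d A -> normle d (Phi A).
Proof.
move=> d0 cA; have [dE|dn0] := eqVneq d 0.
  have A0 : A = 0.
    apply/trmx_inj/row_matrixP => i; apply/trmx_inj; rewrite trmx0 row0 trmx0.
    rewrite -tr_col trmxK; apply: sqn_eq0.
    have := cA (delta_mx i 0); rewrite dE expr0n mul0r -colE => h.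
    by apply/eqP; rewrite eq_le h sqn_ge0.
  rewrite A0 linear0 => v.
  by rewrite mul0mx /sqn dot0r mulr_ge0 ?exprn_ge0 ?sqn_ge0.
have c1 : normle 1 (d^-1 *: A).
  move=> v; rewrite -scalemxAl sqnZ normrV ?unitfE // exprVn ger0_norm //.
  by rewrite expr1n mul1r ler_pdivrMl ?exprn_gt0 ?lt_def ?dn0.
move=> v; have := russo_dye c1 v.
rewrite linearZ -scalemxAl sqnZ normrV ?unitfE // exprVn ger0_norm //.
by rewrite expr1n mul1r ler_pdivrMl ?exprn_gt0 ?lt_def ?dn0.
Qed.

(** The vectors [u] and [w] split into [m] parts indexed by the second factor, and
[Phi] commutes with slices: the form is a sum of [m^2] entries of the matrices
[Phi (slice X (part u a) (part w b))], controlled by [russo_dye_scaled]. *)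
Lemma normle_ampl_codomain k (X : 'M[C]_(k * n)) :
  normle 1 X -> normle m%:R (ampl Phi X).
Proof.
move=> cX; apply/(normle_formle _ (ler0n _ _)) => u w.
pose part (v : 'cV[C]_(k * m)) a : 'cV[C]_k := \col_i v (mxtens_index (i, a)) 0.
have sqn_part v : sqn v = \sum_a sqn (part v a).
  rewrite sqnE sum_tens exchange_big; apply: eq_bigr => a _.
  by rewrite sqnE; apply: eq_bigr => i _; rewrite mxE.
pose Z a b := slice (ampl Phi X) (part u a) (part w b).
have cZ a b : normle (2^-1 * (sqn (part u a) + sqn (part w b))) (Z a b).
  rewrite /Z slice_ampl; apply: russo_dye_scaled; last exact: normle_slice.
  by rewrite mulr_ge0 ?invr_ge0 ?ler0n ?addr_ge0 ?sqn_ge0.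
have dotE' : dot u (ampl Phi X *m w) =
    \sum_a \sum_b dot (delta_mx a 0) (Z a b *m delta_mx b 0).
  rewrite dotE sum_tens exchange_big; apply: eq_bigr => a _ /=.
  under [RHS]eq_bigr => b _.
    rewrite -colE dotE (bigD1 a) //= big1 ?addr0; last first.
      by move=> a' /negPf aa; rewrite mxE aa rmorph0 mul0r.
    rewrite [delta_mx a 0 _ _]mxE !eqxx rmorph1 mul1r !mxE.
    over.
  rewrite [RHS]exchange_big; apply: eq_bigr => i _.
  rewrite mxE sum_tens exchange_big /= mulr_sumr; apply: eq_bigr => b _.
  by rewrite mulr_sumr; apply: eq_bigr => j _; rewrite !mxE; ring.
rewrite /rdot -(dotC u) dotE' rmorph_sum -big_split /=.
have -> : m%:R * (sqn u + sqn w) =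
    \sum_a \sum_b (sqn (part u a) + sqn (part w b)).
  under eq_bigr do rewrite big_split /= sumr_const card_ord.
  rewrite big_split /= sumr_const card_ord sumrMnl -!sqn_part; ring.
apply: ler_sum => a _; rewrite rmorph_sum -big_split /=; apply: ler_sum => b _.
have d0 : 0 <= 2^-1 * (sqn (part u a) + sqn (part w b)).
  by rewrite mulr_ge0 ?invr_ge0 ?ler0n ?addr_ge0 ?sqn_ge0.
have /(normle_formle _ d0) := cZ a b; move=> /(_ (delta_mx a 0) (delta_mx b 0)).
by rewrite !sqn_delta dotC /rdot; congr (_ <= _); field.
Qed.

(** [X'] below is [[0 X; X* 0]], with [T0] and [T1] the embeddings of the two
halves of [C^(k + k)].  Since [n 1 - X'] is separable its image is positive, and
its form at the vector with halves [u] and [w] is the claim.  The doubling turns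
a form with two arguments into a quadratic one, to which positivity applies. *)
Lemma normle_ampl_domain k (X : 'M[C]_(k * n)) :
  normle 1 X -> normle n%:R (ampl Phi X).
Proof.
move=> cX; apply/(normle_formle _ (ler0n _ _)) => u w.
pose T0 : 'M[C]_(k + k, k) := col_mx 1%:M 0.
pose T1 : 'M[C]_(k + k, k) := col_mx 0 1%:M.
have T0H : T0^H = row_mx 1%:M 0.
  by rewrite tr_col_mx map_row_mx trmxC1 trmx0 map_mx0.
have T1H : T1^H = row_mx 0 1%:M.
  by rewrite tr_col_mx map_row_mx trmxC1 trmx0 map_mx0.
have TT : T0 *m T0^H + T1 *m T1^H = 1%:M.
  rewrite T0H T1H !mul_col_row !(mulmx0, mul0mx, mulmx1) add_block_mx.
  by rewrite !(addr0, add0r) -scalar_mx_block.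
have T00 : T0^H *m T0 = 1%:M by rewrite T0H mul_row_col mulmx1 mulmx0 addr0.
have T11 : T1^H *m T1 = 1%:M by rewrite T1H mul_row_col mulmx1 mulmx0 add0r.
have T01 : T0^H *m T1 = 0 by rewrite T0H mul_row_col mulmx0 mul0mx addr0.
have T10 : T1^H *m T0 = 0 by rewrite T1H mul_row_col mulmx0 mul0mx addr0.
move: T0 T1 TT T00 T11 T01 T10 {T0H T1H} => T0 T1 TT T00 T11 T01 T10.
pose D l (Y Y' : 'M[C]_(k * l)) := (T0 *t 1%:M) *m Y *m (T1^H *t 1%:M) +
   (T1 *t 1%:M) *m Y' *m (T0^H *t 1%:M).
have DE l (Y Y' : 'M[C]_(k * l)) u' w' : dot u' (D l Y Y' *m w') =
    dot ((T0^H *t 1%:M) *m u') (Y *m ((T1^H *t 1%:M) *m w')) +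
    dot ((T1^H *t 1%:M) *m u') (Y' *m ((T0^H *t 1%:M) *m w')).
  rewrite /D mulmxDl dotDr -!mulmxA (dot_adj (T0 *t _)) (dot_adj (T1 *t _)).
  by rewrite !trmxC_tens trmxC1.
have sq l (v : 'cV[C]_((k + k) * l)) :
    sqn v = sqn ((T0^H *t 1%:M) *m v) + sqn ((T1^H *t 1%:M) *m v).
  rewrite /sqn !dot_adjl !trmxC_tens !trmxCK trmxC1 -dotDr !mulmxA -mulmxDl.
  by rewrite !tensmx_mul !mulmx1 -tensmxDl TT tensmx11 mul1mx.
pose X' := D _ X X^H.
have hX' : X'^H = X'.
  rewrite /X' /D trmxCD !trmxCM !trmxC_tens !trmxCK !trmxC1 addrC.
  by rewrite !mulmxA.
have cX' : normle 1 X'.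
  apply/(normle_formle _ ler01) => u' w'.
  have /(normle_formle _ ler01) c1 := cX.
  have /(normle_formle _ ler01) c2 := normle_adj ler01 cX.
  have := lerD (c1 ((T0^H *t 1%:M) *m u') ((T1^H *t 1%:M) *m w'))
               (c2 ((T1^H *t 1%:M) *m u') ((T0^H *t 1%:M) *m w')).
  rewrite /rdot -(dotC u') DE rmorphD /= !dotC [sqn u']sq [sqn w']sq.
  by congr (_ <= _); ring.
have psdM := ampl_cone (tens_cone_contraction_r hX' cX').
have ampl1 l : ampl Phi (1%:M : 'M_(l * n)) = 1%:M *t Phi 1%:M.
  by rewrite -tensmx11 ampl_tens.
have aX' : ampl Phi X' = D _ (ampl Phi X) (ampl Phi X^H).
  by rewrite /X' /D linearD /= !ampl_mul.
move: psdM; rewrite linearB linearZ /= ampl1 aX' => psdM.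
set Y := ampl Phi X in psdM *; set Y2 := ampl Phi X^H in psdM.
have hD : (D _ Y Y2)^H = D _ Y Y2.
  have := psd_herm psdM; rewrite trmxCB trmxCZ rmorph_nat trmxC_tens trmxC1.
  by rewrite (psd_herm (Phi_pos (psd1 C n))) => /addrI/oppr_inj.
(* Since [n 1 - X'] has a hermitian image, so does [X'], and its corners are
   [Y] and [Y2]. *)
have YE : Y2^H = Y.
  have e0 : Y = (T0^H *t 1%:M) *m D _ Y Y2 *m (T1 *t 1%:M).
    rewrite /D mulmxDr mulmxDl !mulmxA tensmx_mul T00 mulmx1 tensmx11 mul1mx.
    rewrite tensmx_mul T01 tens0mx !mul0mx addr0 -mulmxA tensmx_mul T11 mulmx1.
    by rewrite tensmx11 mulmx1.
  have e1 : Y2 = (T1^H *t 1%:M) *m D _ Y Y2 *m (T0 *t 1%:M).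
    rewrite {1}/D mulmxDr mulmxDl !mulmxA tensmx_mul T10 tens0mx !mul0mx add0r.
    rewrite tensmx_mul T11 mulmx1 tensmx11 mul1mx -mulmxA tensmx_mul T00 mulmx1.
    by rewrite tensmx11 mulmx1.
  by rewrite [in LHS]e1 [RHS]e0 !trmxCM !trmxC_tens !trmxC1 trmxCK hD mulmxA.
pose v := (T0 *t 1%:M) *m u + (T1 *t 1%:M) *m w : 'cV[C]_((k + k) * m).
have v0 : (T0^H *t 1%:M) *m v = u.
  rewrite mulmxDr !mulmxA !tensmx_mul T00 T01 mulmx1 tensmx11 tens0mx.
  by rewrite mul1mx mul0mx addr0.
have v1 : (T1^H *t 1%:M) *m v = w.
  rewrite mulmxDr !mulmxA !tensmx_mul T10 T11 mulmx1 tensmx11 tens0mx.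
  by rewrite mul1mx mul0mx add0r.
have := psd_ge0 v psdM.
rewrite mulmxBl -scaleN1r dotDr dotZr mulN1r subr_ge0 -scalemxAl dotZr DE v0 v1.
have -> : dot w (Y2 *m u) = dot (Y *m w) u by rewrite dot_adj YE.
rewrite /rdot => /le_trans; apply.
rewrite ler_wpM2l ?ler0n // -{1}v0 -{1}v1 -sq -subr_ge0.
have := psd_ge0 v (psd_tens (psd1 C (k + k)) Phi1_le).
have -> : 1%:M *t (1%:M - Phi 1%:M) = 1%:M - 1%:M *t Phi 1%:M :> 'M[C]_((k + k) * m).
  by rewrite -scaleN1r tensmxDr tensmxZr tensmx11 scaleN1r.
by rewrite mulmxBl mul1mx -scaleN1r dotDr dotZr mulN1r.
Qed.

End Ampl.
End Maps.

(** * The flip and the transposition *)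

Section Flip.
Variable C : numClosedFieldType.

Lemma sum_ord_eq p (a : nat) : \sum_(i < p) (i == a :> nat)%:R = (a < p)%N%:R :> C.
Proof.
case: ltnP => h.
  rewrite (bigD1 (Ordinal h)) //= eqxx big1 ?addr0 // => i.
  by rewrite -val_eqE /= => /negPf ->.
rewrite big1 // => i _; rewrite ltn_eqF //; exact: leq_trans h.
Qed.

(** By [2 Re (a* b) <= |a|^2 + |b|^2], weighted by the entries of [F]. *)
Lemma schur_test p (F : 'M[C]_p) : F^T = F -> (forall x y, 0 <= F x y) ->
  (forall x, \sum_y F x y <= 1) -> normle 1 F.
Proof.
move=> FT F0 F1; apply/(normle_formle _ ler01) => u w; rewrite mul1r.
have le x y : (u x 0)^* * w y 0 + ((u x 0)^* * w y 0)^* <=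
    `|u x 0| ^+ 2 + `|w y 0| ^+ 2.
  rewrite -subr_ge0 rmorphM /= conjCK.
  have -> : `|u x 0| ^+ 2 + `|w y 0| ^+ 2 -
     ((u x 0)^* * w y 0 + u x 0 * (w y 0)^*) = `|u x 0 - w y 0| ^+ 2.
    by rewrite !normCK rmorphB /=; ring.
  by rewrite exprn_ge0.
have -> : rdot u (F *m w) = \sum_x \sum_y
    F x y * ((u x 0)^* * w y 0 + ((u x 0)^* * w y 0)^*).
  rewrite /rdot -(dotC u) dotE rmorph_sum -big_split; apply: eq_bigr => x _ /=.
  rewrite mxE mulr_sumr rmorph_sum -big_split; apply: eq_bigr => y _ /=.
  by rewrite !rmorphM /= (CrealP (ger0_real (F0 x y))); ring.
apply: (@le_trans _ _ (\sum_x \sum_y F x y * (`|u x 0| ^+ 2 + `|w y 0| ^+ 2))).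
  by apply: ler_sum => x _; apply: ler_sum => y _; rewrite ler_wpM2l.
under eq_bigr do under eq_bigr do rewrite mulrDr.
under eq_bigr do rewrite big_split.
rewrite big_split /= [X in _ + X]exchange_big /= !sqnE; apply: lerD.
  by apply: ler_sum => x _; rewrite -mulr_suml ler_piMl // exprn_ge0.
apply: ler_sum => y _; rewrite -mulr_suml ler_piMl ?exprn_ge0 //.
by rewrite (eq_bigr (F y)) // => x _; rewrite -[in LHS]FT mxE.
Qed.

(** The indices are compared as naturals, so that for [p != q] this is the flip of
the common [minn p q] coordinates, extended by zero. *)
Definition flipmx p q : 'M[C]_(p * q) := \matrix_(x, y)
  (((mxtens_unindex y).2 == (mxtens_unindex x).1 :> nat) &&
   ((mxtens_unindex y).1 == (mxtens_unindex x).2 :> nat))%:R.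

Lemma flipmxE p q i a j b :
  flipmx p q (mxtens_index (i, a)) (mxtens_index (j, b)) =
  ((b == i :> nat) && (j == a :> nat))%:R.
Proof. by rewrite mxE !mxtens_indexK. Qed.

Lemma flipmx_tr p q : (flipmx p q)^T = flipmx p q.
Proof.
apply/matrixP => x y; rewrite !mxE andbC; congr (_ _)%:R.
by congr andb; apply: eq_sym.
Qed.

Lemma flipmx_herm p q : (flipmx p q)^H = flipmx p q.
Proof. by rewrite flipmx_tr; apply/matrixP => x y; rewrite !mxE rmorph_nat. Qed.

Lemma normle_flip p q : normle 1 (flipmx p q).
Proof.
apply: schur_test => [|x y|x]; first exact: flipmx_tr.
  by rewrite mxE ler0n.
case: (mxtens_indexP x) => i a; rewrite sum_tens.
under eq_bigr => j _ do under eq_bigr => b _ do rewrite flipmxE andbC -mulnb natrM.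
under eq_bigr do rewrite -mulr_sumr sum_ord_eq.
rewrite -mulr_suml sum_ord_eq -natrM mulnb.
by case: (_ && _); rewrite ?ler01.
Qed.

Section TransMap.
Variables (n m : nat) (i0 : 'I_n).

Let T : 'M[C]_(m, n) := pid_mx n.

(** Transposition on the common coordinates.  When [n < m] the remaining corner is
the unital positive map [A |-> A i0 i0 *: 1]; when [m <= n] it is empty. *)
Definition trans_map (A : 'M[C]_n) : 'M[C]_m :=
  T *m A^T *m T^T + A i0 i0 *: (1%:M - T *m T^T).

Fact trans_map_linear : linear trans_map.
Proof.
move=> c A B; rewrite /trans_map linearP /= mulmxDr mulmxDl -scalemxAr -scalemxAl.
have -> : (c *: A + B) i0 i0 = c * A i0 i0 + B i0 i0 by rewrite !mxE.
by rewrite scalerDl -scalerA [in RHS]scalerDr addrACA.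
Qed.

HB.instance Definition _ :=
  GRing.isLinear.Build C 'M[C]_n 'M[C]_m _ trans_map trans_map_linear.

Lemma trans_map1 : trans_map 1%:M = 1%:M.
Proof. by rewrite /trans_map trmx1 mulmx1 mxE eqxx scale1r addrC subrK. Qed.

Let TH : (T^T)^H = T.
Proof. by rewrite trmxK map_pid_mx. Qed.

Lemma psd_tr k (A : 'M[C]_k) : psd A -> psd A^T.
Proof.
move=> /psd_factor[S ->]; rewrite trmx_mul.
have -> : (S^H)^T = map_mx Num.conj S by apply/matrixP => i j; rewrite !mxE.
have -> : S^T = (map_mx Num.conj S)^H.
  by apply/matrixP => i j; rewrite !mxE conjCK.
exact: psd_gram.
Qed.

Lemma trans_map_pos : posmap trans_map.
Proof.
move=> A pA; apply: psdD.
  by rewrite -{1}TH; apply: psd_congr; apply: psd_tr.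
apply: psdZ.
  have := psd_ge0 (delta_mx i0 0) pA; rewrite -colE dotE (bigD1 i0) //= big1.
    by rewrite !mxE !eqxx rmorph1 mul1r addr0.
  by move=> i /negPf ii; rewrite mxE ii rmorph0 mul0r.
have TTE : T *m T^T = pid_mx n by rewrite tr_pid_mx mul_pid_mx !minnn.
have -> : 1%:M - T *m T^T = (1%:M - T *m T^T)^H *m (1%:M - T *m T^T).
  rewrite trmxCB trmxC1 TTE tr_pid_mx map_pid_mx.
  rewrite mulmxBl mul1mx mulmxBr mulmx1 mul_pid_mx.
  by rewrite minnn pid_mx_minv subrr subr0.
exact: psd_gram.
Qed.

Lemma trans_mapE A (a b : 'I_m) (a' b' : 'I_n) :
  a = a' :> nat -> b = b' :> nat -> trans_map A a b = A b' a'.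
Proof.
move=> ha hb.
have TM k (M : 'M[C]_(n, k)) (c : 'I_m) (c' : 'I_n) j :
    c = c' :> nat -> (T *m M) c j = M c' j.
  move=> hc; rewrite mxE (bigD1 c') //= big1 ?addr0.
    by rewrite mxE hc eqxx ltn_ord mul1r.
  move=> c2 /negPf cc; rewrite mxE hc eq_sym.
  by rewrite [_ == _]cc mul0r.
have MT k (M : 'M[C]_(k, n)) (c : 'I_m) (c' : 'I_n) j :
    c = c' :> nat -> (M *m T^T) j c = M j c'.
  move=> hc; have -> : M *m T^T = (T *m M^T)^T by rewrite trmx_mul trmxK.
  by rewrite mxE (TM _ _ _ c') // mxE.
have e0 : (1%:M - T *m T^T) a b = 0.
  rewrite mxE [X in _ + X]mxE (TM _ _ _ a') // !mxE hb ltn_ord andbT.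
  by rewrite -hb -ha -val_eqE /= [(b == a :> nat)]eq_sym subrr.
by rewrite mxE (MT _ _ _ b') // (TM _ _ _ a') // [X in _ + X]mxE e0 mulr0 addr0 mxE.
Qed.

End TransMap.
End Flip.

Section Witness.
Variable C : numClosedFieldType.

(** The unnormalised maximally entangled vector. *)
Definition diagv p t : 'cV[C]_(p * t) :=
  \col_x ((mxtens_unindex x).1 == (mxtens_unindex x).2 :> nat)%:R.

Lemma diagvE p t i a : diagv p t (mxtens_index (i, a)) 0 = (i == a :> nat)%:R.
Proof. by rewrite mxE mxtens_indexK. Qed.

Lemma sum_ord_lt p t : (\sum_(i < p) (i < t) = minn p t)%N.
Proof. by elim: p => [|p IH]; rewrite ?big_ord0 ?big_ord_recr /= ?IH; lia. Qed.

Lemma sum_diag p t :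
  \sum_(i < p) \sum_(a < t) (i == a :> nat)%:R = (minn p t)%:R :> C.
Proof.
rewrite -sum_ord_lt natr_sum; apply: eq_bigr => i _.
by under eq_bigr do rewrite eq_sym; rewrite sum_ord_eq.
Qed.

Lemma sqn_diagv p t : sqn (diagv p t) = (minn p t)%:R.
Proof.
rewrite sqnE sum_tens -sum_diag; apply: eq_bigr => i _; apply: eq_bigr => a _.
by rewrite diagvE; case: eqP => _; rewrite ?normr1 ?normr0 ?expr1n ?expr0n.
Qed.

Lemma dot_ampl_flip p q t (i0 : 'I_q) : (minn p t <= q)%N ->
  dot (diagv p t) (ampl (trans_map t i0) (flipmx C p q) *m diagv p t) =
  (minn p t)%:R ^+ 2.
Proof.
move=> kq; rewrite expr2 -{1}sum_diag mulr_suml dotE sum_tens.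
apply: eq_bigr => i _; rewrite mulr_suml; apply: eq_bigr => a _.
rewrite diagvE rmorph_nat; case: eqP => [ia|_]; last by rewrite !mul0r.
rewrite !mul1r mxE sum_tens -sum_diag.
apply: eq_bigr => j _; apply: eq_bigr => b _.
rewrite diagvE; case: eqP => [jb|_]; last by rewrite mulr0.
have iq : (i < q)%N by apply: leq_trans kq; rewrite leq_min ltn_ord ia ltn_ord.
have jq : (j < q)%N by apply: leq_trans kq; rewrite leq_min ltn_ord jb ltn_ord.
rewrite mulr1 amplE (@trans_mapE _ _ _ _ _ _ _ (Ordinal iq) (Ordinal jq)) //.
by rewrite mxE flipmxE /= !eqxx.
Qed.

(** Both arguments of the form are [diagv p t], of squared norm [k = minn p t]:
the bound [2 k^2 <= 2 c k] results. *)
Lemma ampl_flip_norm p q t (i0 : 'I_q) (c : C) :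
  (0 < minn p t <= q)%N -> 0 <= c ->
  normle c (ampl (trans_map t i0) (flipmx C p q)) -> (minn p t)%:R <= c.
Proof.
move=> /andP[k0 kq] c0 /(normle_formle _ c0) /(_ (diagv p t) (diagv p t)).
rewrite /rdot -(dotC (diagv p t)) dot_ampl_flip // rmorphXn rmorph_nat.
rewrite sqn_diagv mulrDr -!mulr2n ler_pMn2r //.
by rewrite expr2 ler_pM2r // ltr0n.
Qed.

(** Here the map is the plain transposition of [M_q], which turns [1 - r F] into a
positive element; its form at [diagv p q] is [k - r k^2]. *)
Lemma cone_flip_le p q (r : C) : (0 < minn p q)%N ->
  tens_cone (1%:M - r *: flipmx C p q) -> r <= (minn p q)%:R^-1.
Proof.
move=> k0; have q0 : (0 < q)%N by lia.
pose i0 := Ordinal q0 => h.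
have := psd_ge0 (diagv p q) (ampl_cone (@trans_map_pos C q q i0) h).
rewrite linearB linearZ /= -tensmx11 ampl_tens /= trans_map1 tensmx11.
rewrite mulmxBl mul1mx -scaleN1r dotDr dotZr mulN1r -scalemxAl dotZr.
rewrite dot_ampl_flip ?geq_minr // -/(sqn _) sqn_diagv subr_ge0.
have k0' : 0 < (minn p q)%:R :> C by rewrite ltr0n.
rewrite expr2 mulrA -[X in _ <= X -> _]mul1r ler_pM2r // => h1.
by rewrite -[leRHS]mul1r ler_pdivlMr.
Qed.

(** [k X] is a contraction for [k = minn n m], so [k 1 - k X] is separable; which
factor is cut into blocks depends on which one is smaller. *)
Lemma tens_cone_ball n m (X : 'M[C]_(n * m)) : (0 < minn n m)%N ->
  X^H = X -> normle ((minn n m)%:R^-1) X -> tens_cone (1%:M - X).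
Proof.
move=> k0 hX cX; set k : C := (minn n m)%:R.
have kp : 0 < k by rewrite ltr0n.
have kn : k != 0 by rewrite gt_eqF.
have hkX : (k *: X)^H = k *: X by rewrite trmxCZ hX rmorph_nat.
have ckX : normle 1 (k *: X).
  move=> v; rewrite -scalemxAl sqnZ expr1n mul1r (ger0_norm (ltW kp)).
  rewrite -ler_pdivlMl ?exprn_gt0 // -exprVn; exact: cX.
have -> : 1%:M - X = k^-1 *: (k *: 1%:M - k *: X).
  by rewrite -scalerBr scalerA mulVf // scale1r.
apply: tens_coneZ; first by rewrite invr_ge0 ltW.
rewrite {1}/k /minn; case: ifP => _.
  exact: tens_cone_contraction_l.
exact: tens_cone_contraction_r.
Qed.

End Witness.

(** * The norms and constants of the statement *)

Section Constants.
Variable R : realType.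
Local Notation C := R[i].
Local Open Scope complex_scope.

Lemma vnorm_ge0 n (v : 'cV[C]_n) : 0 <= vnorm v.
Proof. exact: sqrtr_ge0. Qed.

Lemma vnormE n (v : 'cV[C]_n) : (vnorm v)%:C ^+ 2 = sqn v.
Proof.
rewrite -rmorphXn /= sqr_sqrtr; last by apply: sumr_ge0 => i _; rewrite sqr_ge0.
by rewrite sqnE rmorph_sum; apply: eq_bigr => i _; rewrite rmorphXn.
Qed.

Lemma vnorm_le n p (v : 'cV[C]_n) (w : 'cV[C]_p) c : 0 <= c ->
  (vnorm v <= c * vnorm w) = (sqn v <= c%:C ^+ 2 * sqn w).
Proof.
move=> c0; rewrite -!vnormE -exprMn -rmorphM -!rmorphXn lecR.
by rewrite ler_pXn2r // nnegrE ?mulr_ge0 ?vnorm_ge0.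
Qed.

Lemma opnorm_le n (A : 'M[C]_n) (c : R) : 0 <= c ->
  (opnorm A <= c%:E)%E <-> normle c%:C A.
Proof.
move=> c0; split=> h.
  move=> v; rewrite -vnorm_le //.
  have [v0|v0] := eqVneq (vnorm v) 0.
    have -> : v = 0 by apply: sqn_eq0; rewrite -vnormE v0 rmorph0 expr0n.
    rewrite mulmx0 vnorm_le // /sqn dot0r mulr0 //.
  have vp : 0 < vnorm v by rewrite lt_def v0 vnorm_ge0.
  have hZ p (w : 'cV[C]_p) : vnorm ((vnorm v)^-1%:C *: w) = (vnorm v)^-1 * vnorm w.
    have i0 : 0 <= (vnorm v)^-1 by rewrite invr_ge0 ltW.
    apply/eqP; rewrite -(@eqrXn2 _ 2) ?mulr_ge0 ?vnorm_ge0 //.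
    apply/eqP/complexI; rewrite !rmorphXn /= vnormE sqnZ rmorphM exprMn vnormE.
    by rewrite ger0_norm // ler0c.
  have : ((vnorm (A *m ((vnorm v)^-1%:C *: v)))%:E <= c%:E)%E.
    apply: le_trans h; apply: ereal_sup_ubound.
    exists ((vnorm v)^-1%:C *: v) => //=.
    by rewrite hZ mulVf.
  by rewrite lee_fin -scalemxAr hZ ler_pdivrMl // mulrC.
apply: ge_ereal_sup => _ [v /= v1 <-]; rewrite lee_fin.
have := h v; rewrite -vnorm_le // => /le_trans; apply.
by rewrite -[leRHS]mulr1 ler_wpM2l.
Qed.

Lemma opnorm_ge0 n (A : 'M[C]_n) : (0 <= opnorm A)%E.
Proof.
have v0 : vnorm (0 : 'cV[C]_n) = 0.
  apply: complexI; rewrite rmorph0; apply/eqP.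
  have /eqP := vnormE (0 : 'cV[C]_n).
  by rewrite [X in _ == X]dot0r expf_eq0.
apply: (@le_trans _ _ (vnorm (A *m 0))%:E); first by rewrite lee_fin vnorm_ge0.
apply: ereal_sup_ubound.
by exists 0 => //=; rewrite v0.
Qed.

Lemma mapnorm_le n m (Phi : 'M[C]_n -> 'M[C]_m) (c : R) : 0 <= c ->
  (mapnorm Phi <= c%:E)%E <-> forall A, normle 1 A -> normle c%:C (Phi A).
Proof.
move=> c0; split=> h.
  move=> A cA; apply/opnorm_le => //; apply: le_trans h.
  by apply: ereal_sup_ubound; exists A => //=; apply/opnorm_le.
apply: ge_ereal_sup => _ [A /= /(opnorm_le _ ler01) cA <-].
by apply/opnorm_le => //; apply: h.
Qed.

(** [2 <v, Phi(1) v> <= 2 |v|^2], as [Phi 1] is a contraction. *)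
Lemma contractive_map1 n m (Phi : 'M[C]_n -> 'M[C]_m) :
  contractive_map Phi -> positive_map Phi -> psd (1%:M - Phi 1%:M).
Proof.
move=> /(mapnorm_le _ ler01) cPhi pPhi.
have c1 : normle 1 (1%:M : 'M[C]_n).
  by move=> v; rewrite mul1mx expr1n mul1r.
have h1 := psd_herm (pPhi _ (psd1 C n)).
apply/psdP; rewrite trmxCB trmxC1 h1; split=> // v.
have /(normle_formle _ ler01) := cPhi _ c1; move=> /(_ v v).
rewrite mulmxBl mul1mx -scaleN1r dotDr dotZr mulN1r subr_ge0 mul1r.
rewrite /rdot [dot (_ *m _) _]dot_adjl h1 -!mulr2n.
by rewrite ler_pMn2r.
Qed.

Lemma cbnorm_le n m (Phi : {linear 'M[C]_n -> 'M[C]_m}) :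
  positive_map Phi -> psd (1%:M - Phi 1%:M) ->
  (cbnorm Phi <= ((minn n m)%:R : R)%:E)%E.
Proof.
move=> pPhi Phi1; apply: ge_ereal_sup => _ [k /= k0 <-].
apply/mapnorm_le; rewrite ?ler0n // => X cX; rewrite rmorph_nat.
rewrite /minn; case: ifP => _.
  exact: normle_ampl_domain.
exact: normle_ampl_codomain.
Qed.

Lemma cbnorm_trans_ge n m (i0 : 'I_n) : (0 < m)%N ->
  (((minn n m)%:R : R)%:E <= cbnorm (@trans_map C n m i0))%E.
Proof.
move=> m0; have n0 : (0 < n)%N by apply: leq_ltn_trans (ltn_ord i0).
have cF : (opnorm (flipmx C n n) <= 1)%E.
  by apply/(opnorm_le _ ler01); apply: normle_flip.
pose Y := id_tens (@trans_map C n m i0) (flipmx C n n).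
apply: (@le_trans _ _ (opnorm Y)); last first.
  apply: (@le_trans _ _ (mapnorm (@id_tens R n m n (@trans_map C n m i0)))).
    by apply: ereal_sup_ubound; exists (flipmx C n n).
  by apply: ereal_sup_ubound; exists n.
have := opnorm_ge0 Y; case E : (opnorm Y) => [c| |]; [|by move=> _; rewrite leey|by []].
rewrite !lee_fin => c0; rewrite -lecR rmorph_nat.
have cY : normle c%:C Y by apply/opnorm_le; rewrite // E.
apply: ampl_flip_norm cY; first by rewrite geq_minl leq_min n0 m0.
by rewrite ler0c.
Qed.

Lemma trans_map_contractive n m (i0 : 'I_n) :
  contractive_map (@trans_map C n m i0).
Proof.
apply/(mapnorm_le _ ler01) => A; apply: russo_dye; first exact: trans_map_pos.
by rewrite /= trans_map1 subrr; apply: psd0.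
Qed.

End Constants.

Theorem theorem3p6 (R : realType) (n m : nat) (hn : (0 < n)%N) (hm : (0 < m)%N) :
  gamma R n m = (((minn n m)%:R : R)^-1)%:E /\
  eta R n m = ((minn n m)%:R : R)%:E /\
  eta_u R n m = ((minn n m)%:R : R)%:E.
Proof.
have k0 : (0 < minn n m)%N by rewrite leq_min hn hm.
pose i0 := Ordinal hn.
split; [|split].
- apply/eqP; rewrite eq_le; apply/andP; split.
    apply: ge_ereal_sup => _ [r /= [r0 h] <-]; rewrite lee_fin.
    rewrite -lecR fmorphV rmorph_nat; apply: cone_flip_le => //.
    rewrite -tensmx11; apply: h.
      by apply/hermP; rewrite trmxCZ flipmx_herm (CrealP (ger0_real _)) ?ler0c.
    apply/opnorm_le => // v; rewrite -scalemxAl sqnZ ger0_norm ?ler0c //.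
    rewrite ler_wpM2l ?exprn_ge0 ?ler0c //.
    by have := @normle_flip R[i] n m v; rewrite expr1n mul1r.
  apply: ereal_sup_ubound; exists ((minn n m)%:R^-1) => //=.
  split=> [|x /hermP hx]; first by rewrite invr_ge0 ler0n.
  move=> /opnorm_le; rewrite invr_ge0 ler0n fmorphV rmorph_nat => /(_ isT) cx.
  by rewrite tensmx11; apply: tens_cone_ball.
- apply/eqP; rewrite eq_le; apply/andP; split.
    apply: ge_ereal_sup => _ [Phi /= [cPhi pPhi] <-].
    by apply: cbnorm_le => //; apply: contractive_map1.
  apply: (le_trans (cbnorm_trans_ge R i0 hm)); apply: ereal_sup_ubound.
  exists (@trans_map R[i] n m i0) => //=; split.
    exact: trans_map_contractive.
  exact: trans_map_pos.
- apply/eqP; rewrite eq_le; apply/andP; split.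
    apply: ge_ereal_sup => _ [Phi /= [uPhi pPhi] <-].
    by apply: cbnorm_le => //; rewrite uPhi subrr; apply: psd0.
  apply: (le_trans (cbnorm_trans_ge R i0 hm)); apply: ereal_sup_ubound.
  exists (@trans_map R[i] n m i0) => //=; split.
    exact: trans_map1.
  exact: trans_map_pos.
Qed.
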